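(* Multistage 2-SAT is solvable in $O(\min\{2^{n}n^{d},4^{n}\}\cdot\tau\cdot(n+m))$ time.
   Context: A 2-CNF formula is a conjunction of clauses, each a disjunction of at most two literals (variables or negated variables). Multistage 2-SAT: the input is a set $X$ of variables, a sequence $\Phi=(\phi_1,\dots,\phi_\tau)$, $\tau\ge 1$, of 2-CNF formulas (the ''stages'') over literals over $X$, and an integer $d\ge 0$. The question is whether there are $\tau$ truth assignments $f_1,\dots,f_\tau\colon X\to\{\bot,\top\}$ such that (i) for each $i\in\{1,\dots,\tau\}$, $f_i$ satisfies $\phi_i$, and (ii) for each $i\in\{1,\dots,\tau-1\}$, $|\{x\in X\mid f_i(x)\ne f_{i+1}(x)\}|\le d$. Here $n=|X|$ is the number of variables and $m$ is the maximum number of clauses in any stage. *)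

(* Defs.v *)
From mathcomp Require Import all_boot.

Set Implicit Arguments.
Unset Strict Implicit.
Unset Printing Implicit Defensive.

(** * Multistage 2-SAT, with variable set [X = 'I_n] *)

Definition assignment (n : nat) := {ffun 'I_n -> bool}.

(* [(x, true)] is the literal x and [(x, false)] is its negation. *)
Definition literal (n : nat) := ('I_n * bool)%type.

(* A clause is a sequence of at most two literals; the empty clause is allowed
   and is unsatisfiable. *)
Definition clause (n : nat) := 2.-bseq (literal n).

Definition cnf2 (n : nat) := seq (clause n).

Definition sat_literal n (f : assignment n) (l : literal n) : bool :=
  f l.1 == l.2.

Definition sat_clause n (f : assignment n) (c : clause n) : bool :=
  has (sat_literal f) c.

Definition sat_cnf2 n (f : assignment n) (phi : cnf2 n) : bool :=
  all (sat_clause f) phi.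

Definition multistage_2sat n tau (d : nat) (Phi : tau.-tuple (cnf2 n)) : Prop :=
  exists f : 'I_tau -> assignment n,
    (forall i, sat_cnf2 (f i) (tnth Phi i)) /\
    (forall i j : 'I_tau, j = i.+1 :> nat ->
       #|[set x : 'I_n | f i x != f j x]| <= d).

Definition max_clauses n tau (Phi : tau.-tuple (cnf2 n)) : nat :=
  \max_(i < tau) size (tnth Phi i).

(** * Random access machine, uniform cost criterion

   Registers are addressed by constants occurring in the program, memory cells
   indirectly through registers; both hold natural numbers. Every executed
   instruction costs one time unit. As is usual for the uniform cost criterion,
   the only arithmetic is addition and (truncated) subtraction: with unit-cost
   multiplication the model would be unreasonably powerful. *)

Inductive instr :=
| Const (r k : nat)     (* R[r] := k *)
| Copy  (r s : nat)     (* R[r] := R[s] *)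
| Add   (r s t : nat)   (* R[r] := R[s] + R[t] *)
| Sub   (r s t : nat)   (* R[r] := R[s] - R[t], or 0 if R[s] < R[t] *)
| Read  (r s : nat)     (* R[r] := M[R[s]] *)
| Write (r s : nat)     (* M[R[r]] := R[s] *)
| Jump  (l : nat)
| Jzero (r l : nat)     (* if R[r] = 0 then jump to l *)
| Halt.

Definition program := seq instr.

Record config := Config { pc : nat; reg : nat -> nat; mem : nat -> nat }.

Definition update (g : nat -> nat) (a v : nat) : nat -> nat :=
  fun b => if b == a then v else g b.

(* Running off the end of the program halts. *)
Definition current (P : program) (s : config) : instr := nth Halt P (pc s).

(* A halted configuration is a fixed point of [step]. *)
Definition step (P : program) (s : config) : config :=
  let: Config p R M := s in
  let set r v := Config p.+1 (update R r v) M in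
  match current P s with
  | Const r k => set r k
  | Copy r a => set r (R a)
  | Add r a b => set r (R a + R b)
  | Sub r a b => set r (R a - R b)
  | Read r a => set r (M (R a))
  | Write r a => Config p.+1 R (update M (R r) (R a))
  | Jump l => Config l R M
  | Jzero r l => Config (if R r == 0 then l else p.+1) R M
  | Halt => s
  end.

(* The input word occupies memory cells 0, 1, ..., and its length is in
   register 0; everything else is 0. *)
Definition init (w : seq nat) : config :=
  Config 0 (update (fun=> 0) 0 (size w)) (nth 0 w).

(* On input [w], [P] halts within [t] steps and answers [b] in register 0. *)
Definition answers_within (P : program) (w : seq nat) (t : nat) (b : bool) :
    Prop :=
  let s := iter t (step P) (init w) in
  current P s = Halt /\ reg s 0 = b.

(** * Encoding of instances as input words *)

Definition encode_literal n (l : literal n) : seq nat :=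
  [:: nat_of_ord l.1; nat_of_bool l.2].

Definition encode_clause n (c : clause n) : seq nat :=
  size c :: flatten [seq encode_literal l | l <- c].

Definition encode_cnf2 n (phi : cnf2 n) : seq nat :=
  size phi :: flatten [seq encode_clause c | c <- phi].

Definition encode n tau (d : nat) (Phi : tau.-tuple (cnf2 n)) : seq nat :=
  [:: n, d, tau & flatten [seq encode_cnf2 phi | phi <- Phi]].

(* Main.v *)
Require Import Defs.
From mathcomp Require Import all_boot.
From mathcomp Require Import zify.

(** Dynamic programming over the stages: maintain for each of the 2^n
    assignments f the number d + 1 - dist(f, S), truncated at 0, where S is the
    set of assignments that can end a valid sequence for the stages read so far.
    A stage keeps d + 1 at the assignments with positive value that satisfy its
    formula, resets all others to 0, and then propagates: for each variable x in
    turn, every value becomes the maximum of itself and the value at the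
    assignment with x flipped, minus 1. Since the Hamming distance is a sum over
    the variables, one pass per variable suffices. A stage thus takes
    O(2^n (n + m)) steps, independently of d, and 2^n is at most
    min(2^n n^d, 4^n) when n > 0.

    The random access machine program is compiled from a language with
    straight-line code, sequencing and counted loops, whose programs are
    verified with Hoare triples that include a bound on the running time. *)

Set Implicit Arguments.
Unset Strict Implicit.
Unset Printing Implicit Defensive.

(** * Structured programs for the random access machine *)

Section Segment.
Variable T : Type.
Implicit Types (M : nat -> T) (u v : seq T).

(** Serves both for input words in memory and for code inside a program, hence the arbitrary type of
    cell contents. The end address [e] is explicit so that it stays fixed while a prefix of the word
    is consumed. *)
Fixpoint segment M a u e : Prop :=
  if u is x :: v then M a = x /\ segment M a.+1 v e else a = e.

Lemma segment_end M a u e : segment M a u e -> a + size u = e.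
Proof.
by elim: u a => [|x u IH] a /=; [rewrite addn0 | case=> _ /IH; rewrite addSnnS].
Qed.

Lemma segment_cat M a u v e :
  segment M a (u ++ v) e <->
  segment M a u (a + size u) /\ segment M (a + size u) v e.
Proof.
elim: u a => [|x u IH] a /=; first by rewrite addn0; intuition.
by rewrite IH addSnnS; tauto.
Qed.

Lemma segment_nth x0 u : segment (nth x0 u) 0 u (size u).
Proof.
suff H v : segment (nth x0 (v ++ u)) (size v) u (size (v ++ u)) by apply: (H [::]).
elim: u v => [|x u IH] v /=; first by rewrite cats0.
by split; [rewrite nth_cat ltnn subnn | have := IH (rcons v x);
  rewrite cat_rcons size_rcons].
Qed.

Lemma eq_segment M M' a u e :
  (forall b, b < e -> M' b = M b) -> segment M a u e -> segment M' a u e.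
Proof.
move=> eqM; elim: u a => [|x u IH] a //= [<- Hu]; split; last exact: IH.
by apply: eqM; have := segment_end Hu; lia.
Qed.

End Segment.

(** * Semantics, running time and compilation of loop programs *)

Definition state := ((nat -> nat) * (nat -> nat))%type.

Definition mset : (nat -> nat) -> nat -> nat -> nat -> nat := update.

Lemma msetE M a v b : mset M a v b = if b == a then v else M b.
Proof. by []. Qed.

(* Convertible to [update], but free of the [eqType] layer, so that register
   look-ups at numerals reduce by unfolding [Nat.eqb] alone. *)
Definition rset (R : nat -> nat) r v : nat -> nat :=
  fun b => if Nat.eqb b r then v else R b.

Lemma rsetE R r v b : rset R r v b = if b == r then v else R b.
Proof. by []. Qed.

Definition effect (s : state) (i : instr) : state :=
  let: (R, M) := s in
  match i with
  | Const r k => (rset R r k, M)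
  | Copy r a => (rset R r (R a), M)
  | Add r a b => (rset R r (R a + R b), M)
  | Defs.Sub r a b => (rset R r (R a - R b), M)
  | Read r a => (rset R r (M (R a)), M)
  | Write r a => (R, mset M (R r) (R a))
  | _ => s
  end.

Definition straight (i : instr) :=
  match i with Jump _ | Jzero _ _ | Halt => false | _ => true end.

Definition target (i : instr) : seq nat :=
  match i with
  | Const r _ | Copy r _ | Add r _ _ | Defs.Sub r _ _ | Read r _ => [:: r]
  | _ => [::]
  end.

Inductive com :=
| Ops of seq instr
| Seq of com & com
| For of nat & com.

Local Notation "c1 ;; c2" := (Seq c1 c2) (at level 90, right associativity).

(* Register 1 permanently holds the constant 1; [wf] forbids writing to it. *)
Definition dec r (s : state) : state := effect s (Defs.Sub r r 1).

(** The number of rounds of a loop is fixed on entry. This agrees with the machine because [wf]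
    keeps the body from writing the counter. *)
Fixpoint sem c s : state :=
  match c with
  | Ops l => foldl effect s l
  | c1 ;; c2 => sem c2 (sem c1 s)
  | For r c => iter (s.1 r) (fun s => dec r (sem c s)) s
  end.

(** A round costs its body plus three instructions: test, decrement and jump back. The final 1 is
    the test that leaves the loop. *)
Fixpoint time c s : nat :=
  match c with
  | Ops l => size l
  | c1 ;; c2 => time c1 s + time c2 (sem c1 s)
  | For r c =>
      (fix loop k s :=
         if k is k'.+1 then time c s + 3 + loop k' (dec r (sem c s)) else 1)
      (s.1 r) s
  end.

Fixpoint writes c : seq nat :=
  match c with
  | Ops l => flatten (map target l)
  | c1 ;; c2 => writes c1 ++ writes c2
  | For r c => r :: writes c
  end.

Fixpoint pure c : bool :=
  match c with
  | Ops l => all (fun i => if i is Write _ _ then false else true) l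
  | c1 ;; c2 => pure c1 && pure c2
  | For _ c => pure c
  end.

Fixpoint wf c : bool :=
  match c with
  | Ops l => all straight l && (1 \notin flatten (map target l))
  | c1 ;; c2 => wf c1 && wf c2
  | For r c => [&& wf c, r \notin writes c & r != 1]
  end.

(** Jump targets are absolute, so the address [p] at which the code will stand is a parameter. *)
Fixpoint compile p c : program :=
  match c with
  | Ops l => l
  | c1 ;; c2 => let u := compile p c1 in u ++ compile (p + size u) c2
  | For r c =>
      let u := compile p.+1 c in
      Jzero r (p + size u + 3) :: u ++ [:: Defs.Sub r r 1; Jump p]
  end.

Lemma effect_frame s i r : r \notin target i -> (effect s i).1 r = s.1 r.
Proof.
by case: s i => R M [a b|a b|a b c|a b c|a b|||| ] //=;
  rewrite inE rsetE => /negbTE ->.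
Qed.

Lemma sem_frame c s r : r \notin writes c -> (sem c s).1 r = s.1 r.
Proof.
elim: c s => [l|c1 IH1 c2 IH2|x c IH] s /=.
- elim: l s => [|i l IH] s //=; rewrite mem_cat negb_or => /andP[ri rl].
  by rewrite IH // effect_frame.
- by rewrite mem_cat negb_or => /andP[r1 r2]; rewrite IH2 // IH1.
- rewrite inE negb_or => /andP[rx rc].
  elim: (s.1 x) => [|k IHk] //=; rewrite /dec effect_frame ?inE //.
  by rewrite IH.
Qed.

Lemma sem_pure c s : pure c -> (sem c s).2 = s.2.
Proof.
elim: c s => [l|c1 IH1 c2 IH2|x c IH] s /=.
- elim: l s => [|i l IH] s //= /andP[ri rl].
  by rewrite IH //; case: s i ri => R M [].
- by move=> /andP[r1 r2]; rewrite IH2 // IH1.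
- move=> pc; elim: (s.1 x) => [|k IHk] //=.
  by rewrite -IHk -[in RHS](IH _ pc) /dec; case: (sem c _).
Qed.

Lemma wf_one c : wf c -> 1 \notin writes c.
Proof.
elim: c => [l|c1 IH1 c2 IH2|x c IH] /=; first by case/andP.
  by case/andP=> /IH1 h1 /IH2 h2; rewrite mem_cat negb_or h1.
by case/and3P=> /IH h _; rewrite inE eq_sym negb_or h andbT.
Qed.

Lemma step_straight P p s i : nth Halt P p = i -> straight i ->
  step P (Config p s.1 s.2) = Config p.+1 (effect s i).1 (effect s i).2.
Proof. by case: s => R M /=; rewrite /current /= => ->; case: i. Qed.

(** Structural induction, with an inner induction on the counter for loops: the body preserves the
    counter and register 1, so each round lowers the counter by exactly one. *)
Lemma compile_ok P c p e s : wf c -> s.1 1 = 1 ->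
  segment (nth Halt P) p (compile p c) e ->
  iter (time c s) (step P) (Config p s.1 s.2) =
  Config (p + size (compile p c)) (sem c s).1 (sem c s).2.
Proof.
elim: c p e s => [l|c1 IH1 c2 IH2|r c IH] p e s /=.
- case/andP=> + _ _; elim: l p s => [|i l IHl] p s; first by rewrite addn0.
  move=> /= /andP[si sl] [Pi Pl].
  by rewrite -iterS iterSr (step_straight _ Pi si) IHl // addSnnS.
- case/andP=> w1 w2 s1 /segment_cat[P1 P2].
  rewrite addnC iterD (IH1 _ _ _ _ _ P1) // (IH2 _ _ _ _ _ P2) //; first by rewrite size_cat addnA.
  by rewrite sem_frame // wf_one.
- case/and3P=> wc rc r1 s1 [Pj] /segment_cat[Pc /= [Ps [Pg _]]].
  set u := compile _ _ in Pj Pc Ps Pg *; rewrite size_cat /=.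
  have [k sr] : exists k, s.1 r = k by exists (s.1 r).
  rewrite sr; elim: k s s1 sr => [|k IHk] s s1 sr.
    by rewrite /= /current /= Pj sr eqxx; congr Config; lia.
  rewrite [iter k.+1 _ s]iterSr.
  (* Split off one round: test and body take [time c s + 1] steps, decrement and back jump take
     2. *)
  rewrite (_ : _ + _ + _ = (fix loop k s := if k is k'.+1 then time c s + 3 +
     loop k' (dec r (sem c s)) else 1) k (dec r (sem c s)) + (2 + (time c s + 1)));
    last by rewrite -addnA addnC; lia.
  have se1 : (sem c s).1 1 = 1 by rewrite sem_frame // wf_one.
  rewrite iterD -IHk; first last.
  - by rewrite /dec; case: (sem c s) (sem_frame s rc) se1 => R M /=;
       rewrite rsetE eqxx => -> ->; lia.
  - by rewrite /dec effect_frame ?inE // eq_sym.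
  congr iter; rewrite iterD.
  have -> : iter (time c s + 1) (step P) (Config p s.1 s.2) =
            Config (p.+1 + size u) (sem c s).1 (sem c s).2.
    by rewrite iterD /= /current /= Pj sr /= -(IH _ _ _ _ _ Pc).
  rewrite iterS iterS [iter 0 _ _]/iter (step_straight _ Ps) //.
  by rewrite /dec; case: (effect _ _) => R M; rewrite /= /current /= Pg.
Qed.

(** * Hoare triples with time bounds *)

Definition runs c s T (Q : state -> Prop) := time c s <= T /\ Q (sem c s).

Lemma runs_leq c s T T' Q : T <= T' -> runs c s T Q -> runs c s T' Q.
Proof. by move=> leT [le_t q]; split=> //; apply: leq_trans leT. Qed.

Lemma runs_imp c s T (Q Q' : state -> Prop) :
  (forall s', Q s' -> Q' s') -> runs c s T Q -> runs c s T Q'.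
Proof. by move=> imp [le_t q]; split=> //; apply: imp. Qed.

Lemma runs_ops l s (Q : state -> Prop) :
  Q (foldl effect s l) -> runs (Ops l) s (size l) Q.
Proof. by []. Qed.

Lemma runs_seq c1 c2 s T1 T2 Q :
  runs c1 s T1 (fun s' => runs c2 s' T2 Q) -> runs (c1 ;; c2) s (T1 + T2) Q.
Proof. by case=> t1 [t2 q]; split=> //=; apply: leq_add. Qed.

Definition framed c (s s' : state) : Prop :=
  (forall r, r \notin writes c -> s'.1 r = s.1 r) /\ (pure c -> s'.2 = s.2).

Lemma runs_frame c s T (Q : state -> Prop) :
  runs c s T Q -> runs c s T (fun s' => framed c s s' /\ Q s').
Proof.
by case=> t q; split=> //; split=> //; split; [move=> r; apply: sem_frame|apply: sem_pure].
Qed.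

(** [I j] is the invariant after [j] rounds, and [F] is a potential that absorbs the cost [T j] of
    each round and its overhead of 3. Since [T] may vary with [j], rounds of growing cost are
    covered. The strict bound on [U] pays for the last test. *)
Lemma runs_for_nat N (I : nat -> state -> Prop) (F T : nat -> nat) r c s U Q :
  wf (For r c) -> s.1 1 = 1 -> s.1 r = N -> I 0 s ->
  (forall j s', j < N -> I j s' -> framed (For r c) s s' ->
     runs c s' (T j) (fun s'' => I j.+1 (dec r s''))) ->
  (forall s', I N s' -> framed (For r c) s s' -> Q s') ->
  (forall j, j < N -> F j + T j + 3 <= F j.+1) -> F N < U ->
  runs (For r c) s U Q.
Proof.
move=> wfc s1 sr I0 body imp leF ltU; have /and3P[wc rc r1] := wfc.
apply: runs_leq ltU _; apply: (@runs_imp _ _ _ (fun s' => framed (For r c) s s' /\ I N s')).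
  by move=> s' [fr IN]; apply: imp.
apply: runs_frame.
pose loop := fix loop k s :=
  if k is k'.+1 then time c s + 3 + loop k' (dec r (sem c s)) else 1.
rewrite /runs /= sr -/loop.
suff H k j s' : k + j = N -> framed (For r c) s s' -> I j s' ->
    loop k s' + F j <= (F N).+1 /\ I N (iter k (fun s => dec r (sem c s)) s').
  by have [|//|//|le_t IN] := H N 0 s; rewrite ?addn0 //; split=> //; lia.
elim: k j s' => [|k IH] j s' eN fr Ij; first by rewrite -eN.
have ltj : j < N by lia.
have [t Ij1] := body _ _ ltj Ij fr.
have fr' : framed (For r c) s (dec r (sem c s')).
  split=> [x|pc].
    rewrite /= inE negb_or => /andP[xr xc].
    by rewrite /dec effect_frame ?inE // sem_frame // fr.1 //= inE negb_or xr.
  by rewrite -(fr.2 pc) -(@sem_pure c s' pc); case: (sem c s').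
have [|le_t IN] := IH j.+1 _ _ fr' Ij1; first by lia.
rewrite iterSr; split=> //=; have := leF _ ltj; lia.
Qed.

(** Here the invariant is indexed by the list still to be processed, which fits loops that parse the
    input. *)
Lemma runs_for_seq (A : eqType) (l : seq A) (I : seq A -> state -> Prop) T
    r c s U Q :
  wf (For r c) -> s.1 1 = 1 -> s.1 r = size l -> I l s ->
  (forall x l' s', x \in l -> I (x :: l') s' -> framed (For r c) s s' ->
     runs c s' T (fun s'' => I l' (dec r s''))) ->
  (forall s', I [::] s' -> framed (For r c) s s' -> Q s') ->
  size l * (T + 3) < U ->
  runs (For r c) s U Q.
Proof.
move=> wfc s1 sr Il body imp ltU.
apply: (@runs_for_nat (size l) (fun j => I (drop j l)) (fun j => j * (T + 3))
  (fun=> T)) => //.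
- by rewrite drop0.
- move=> j s' ltj Ij fr; case: l ltj Ij {sr Il ltU} body => // x0 l ltj.
  by rewrite (drop_nth x0) // => Ij body; apply: body (mem_nth x0 ltj) Ij fr.
- by rewrite drop_size.
- by move=> j _; rewrite mulSn; lia.
Qed.

(** A loop whose counter is 0 or 1 acts as a conditional; 4 is the overhead of one round plus the
    final test. *)
Lemma runs_if (b : bool) r c s T (Q : state -> Prop) :
  wf (For r c) -> s.1 1 = 1 -> s.1 r = b ->
  (b -> runs c s T (fun s' => Q (dec r s'))) -> (~~ b -> Q s) ->
  runs (For r c) s (T + 4) Q.
Proof.
move=> wfc s1 sr Q1 Q0; apply: (@runs_for_nat b
    (fun j s' => if j is 0 then s' = s else Q s') (fun j => j * (T + 3))
    (fun=> T)) => //.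
- by case: b {sr} Q1 Q0 => // Q1 _ [|j] s' //= _ -> _; apply: Q1.
- by case: b {sr Q1} Q0 => // Q0 s' -> _; apply: Q0.
- by move=> j _; rewrite mulSn; lia.
- by case: b {sr Q1 Q0}; lia.
Qed.

(* Call-by-value keeps the register contents shared; [simpl] is exponential in
   the number of instructions. *)
Ltac calc := cbv beta iota zeta delta [foldl effect rset Nat.eqb dec fst snd].
Tactic Notation "unchanged" constr(fr) constr(r) "as" ident(H) :=
  have := fr r isT; calc; move=> H.

(** * The algorithm *)

Local Notation rbase := 0 (only parsing).
Local Notation rone := 1 (only parsing).
Local Notation rn := 2 (only parsing).
Local Notation rbudget := 3 (only parsing).
Local Notation rstages := 4 (only parsing).
Local Notation rinput := 5 (only parsing).
Local Notation rwidth := 6 (only parsing).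
Local Notation rrows := 7 (only parsing).
Local Notation rdst := 8 (only parsing).
Local Notation rcol := 9 (only parsing).
Local Notation rdim := 10 (only parsing).
Local Notation rleft := 11 (only parsing).
Local Notation rsrc := 12 (only parsing).
Local Notation rcells := 13 (only parsing).
Local Notation raddr := 14 (only parsing).
Local Notation rv := 15 (only parsing).
Local Notation rrow := 16 (only parsing).
Local Notation rscan := 17 (only parsing).
Local Notation rclauses := 18 (only parsing).
Local Notation rok := 19 (only parsing).
Local Notation rlits := 20 (only parsing).
Local Notation rtrue := 21 (only parsing).
Local Notation rx := 22 (only parsing).
Local Notation ru := 23 (only parsing).
Local Notation rstride := 24 (only parsing).
Local Notation rans := 25 (only parsing).
Local Notation rbit := 26 (only parsing).

(* The table starts at the cell whose address is in [rbase], just behind the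
   input. Row k consists of the value of the k-th assignment, followed by the n
   bits of k, which are the truth values of that assignment. *)

Definition copy_cell := Ops [:: Read rv rsrc; Write rdst rv;
  Add rsrc rsrc rone; Add rdst rdst rone].

Definition add_row :=
  Ops [:: Add raddr rdst rcol; Copy rcells rwidth];; For rcells copy_cell;;
  Ops [:: Write raddr rone].

(** Doubles the table: each existing row is copied behind the table with the bit in column [rcol]
    set, which yields the rows of the numbers with the next higher bit. *)
Definition add_bit :=
  Ops [:: Copy rsrc rbase; Copy rleft rrows];; For rleft add_row;;
  Ops [:: Add rrows rrows rrows; Add rcol rcol rone].

(** With truncated subtraction, (v - u) + (u - v) is 0 for equal bits and 1 otherwise, so [rtrue]
    counts the true literals. *)
Definition check_literal := Ops
  [:: Read rx rscan; Add rscan rscan rone; Read ru rscan; Add rscan rscan rone;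
      Add rx rx rrow; Add rx rx rone; Read rv rx;
      Defs.Sub raddr rv ru; Defs.Sub rv ru rv; Add rv rv raddr;
      Defs.Sub rv rone rv; Add rtrue rtrue rv].

Definition check_clause :=
  Ops [:: Read rlits rscan; Add rscan rscan rone; Const rtrue 0];;
  For rlits check_literal;;
  Ops [:: Defs.Sub rtrue rone rtrue; Defs.Sub rok rok rtrue].

(** Subtracting [1 - value] from [rok] discards rows whose value is 0. The loop on [rok] is a
    conditional that also records in [rans] that some row survives. *)
Definition filter_row :=
  Ops [:: Copy rscan rinput; Read rclauses rscan; Add rscan rscan rone;
          Copy rok rone];;
  For rclauses check_clause;;
  Ops [:: Read rv rrow; Defs.Sub rv rone rv; Defs.Sub rok rok rv; Const rv 0];;
  For rok (Ops [:: Copy rv rbudget; Copy rans rone]);;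
  Ops [:: Write rrow rv; Add rrow rrow rwidth].

Definition filter_rows :=
  Ops [:: Const rans 0; Copy rrow rbase; Copy rleft rrows];;
  For rleft filter_row;;
  Ops [:: Copy rinput rscan].

(* The row of the assignment that differs in the current variable lies
   [rstride] cells behind or ahead, depending on the bit of that variable. *)
Definition relax_row :=
  Ops [:: Add raddr rrow rcol; Read rbit raddr; Add raddr rrow rstride];;
  For rbit (Ops [:: Defs.Sub raddr rrow rstride]);;
  Ops [:: Read rv raddr; Defs.Sub rv rv rone; Read ru rrow; Defs.Sub rv rv ru;
          Add ru ru rv; Write rrow ru; Add rrow rrow rwidth].

Definition relax_dim :=
  Ops [:: Copy rrow rbase; Copy rleft rrows];;
  For rleft relax_row;;
  Ops [:: Add rstride rstride rstride; Add rcol rcol rone].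

Definition relax_rows :=
  Ops [:: Copy rstride rwidth; Copy rcol rone; Copy rdim rn];;
  For rdim relax_dim.

(** The header [n], [d], [tau] is read from cells 0, 1, 2, and [rbudget] becomes d + 1. Only the
    value cell of row 0 is written: its bits are 0, as are the cells behind the input. *)
Definition setup := Ops
  [:: Const rv 0; Read rn rv; Read rbudget rone; Add rbudget rbudget rone;
      Add rv rone rone; Read rstages rv; Add rinput rv rone;
      Add rwidth rn rone; Write rbase rone; Copy rrows rone;
      Add rdst rbase rwidth; Copy rcol rone; Copy rdim rn; Copy rans rone].

Definition main :=
  setup;; For rdim add_bit;; For rstages (filter_rows;; relax_rows);;
  Ops [:: Copy 0 rans].

Lemma wf_main : wf main. Proof. by []. Qed.

(** * Assignments as numbers, and the distance transform *)

Definition bit (k x : nat) : bool := odd (iter x half k).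

Lemma bitS k x : bit k x.+1 = bit k./2 x.
Proof. by rewrite /bit iterSr. Qed.

Lemma bit_small k x : k < 2 ^ x -> bit k x = false.
Proof.
elim: x k => [|x IH] k; first by rewrite expn0; case: k.
by rewrite expnS bitS => lt_k; apply: IH; lia.
Qed.

(** Adding [2 ^ x] causes no carry when bit [x] is clear. *)
Lemma bit_add k x y : bit k x = false -> bit (k + 2 ^ x) y = bit k y (+) (y == x).
Proof.
elim: x k y => [|x IH] k y.
  rewrite /bit /= addn1 => ev; case: y => [|y]; first by rewrite /= ev.
  by rewrite !iterSr /= addbF uphalf_half ev.
have e : odd (2 * 2 ^ x) = false by rewrite mul2n odd_double.
rewrite bitS expnS => ev; case: y => [|y]; first by rewrite /bit /= oddD e.
by rewrite !bitS -IH //; congr bit; lia.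
Qed.

Lemma bit_leq k x : bit k x -> 2 ^ x <= k.
Proof. by apply: contraTT; rewrite -ltnNge => /bit_small ->. Qed.

Lemma bit_sub k x y : bit k x -> bit (k - 2 ^ x) y = bit k y (+) (y == x).
Proof.
move=> bk; have le := bit_leq bk.
have b0 : bit (k - 2 ^ x) x = false.
  elim: x k bk {y le} => [|x IH] k; first by rewrite /bit /=; case: k => //= k; lia.
  by rewrite !bitS => /IH; rewrite (_ : (_ - _)./2 = k./2 - 2 ^ x) // expnS; lia.
by have := bit_add y b0; rewrite subnK // => ->; rewrite addbK.
Qed.

Lemma bit_onto n (g : nat -> bool) :
  exists2 k, k < 2 ^ n & forall x, x < n -> bit k x = g x.
Proof.
elim: n g => [|n IH] g; first by exists 0.
have [k lt_k bk] := IH (g \o succn); exists (g 0 + k.*2).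
  by rewrite expnS; case: (g 0); lia.
case=> [_|x lt_x]; first by rewrite /bit /= oddD odd_double addbF oddb.
by have /= <- := bk x lt_x; rewrite bitS half_bit_double.
Qed.

(** Exclusive or with [2 ^ x], expressed by the operations of the machine. *)
Definition partner k x := if bit k x then k - 2 ^ x else k + 2 ^ x.

Lemma bit_partner k x y : bit (partner k x) y = bit k y (+) (y == x).
Proof.
by rewrite /partner; case: ifP => b; [apply: bit_sub | apply: bit_add].
Qed.

Lemma partner_lt n k x : x < n -> k < 2 ^ n -> partner k x < 2 ^ n.
Proof.
rewrite /partner; case: ifP => [_ _|]; first by lia.
elim: x n k => [|x IH] [|n] k //; rewrite [2 ^ n.+1]expnS.
  by rewrite /bit /= expn0; lia.
by rewrite bitS expnS => /(IH n) H /H{}H lt_k; have := H ltac:(lia); lia.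
Qed.

Lemma partnerK k x : partner (partner k x) x = k.
Proof.
rewrite {1}/partner bit_partner eqxx addbT /partner.
by case: (boolP (bit k x)) => b /=; rewrite ?addnK // subnK // bit_leq.
Qed.

(** * Hamming distance, distance transform and feasibility *)

Section Assignments.
Variable n : nat.
Implicit Types f g : assignment n.

Definition decode k : assignment n := [ffun x : 'I_n => bit k x].

Lemma decode_onto f : exists2 k, k < 2 ^ n & decode k = f.
Proof.
have [k lt_k bk] := bit_onto n (fun x => if insub x is Some i then f i else false).
by exists k => //; apply/ffunP => x; rewrite ffunE bk // valK.
Qed.

Definition flip m f : assignment n := [ffun x : 'I_n => f x (+) (x == m :> nat)].

Lemma decode_partner k m : decode (partner k m) = flip m (decode k).
Proof. by apply/ffunP => x; rewrite !ffunE bit_partner. Qed.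

Definition dist f g := #|[set x : 'I_n | f x != g x]|.

Lemma distff f : dist f f = 0.
Proof. by apply: eq_card0 => x; rewrite inE eqxx. Qed.

Lemma distC f g : dist f g = dist g f.
Proof. by apply: eq_card => x; rewrite !inE eq_sym. Qed.

Lemma dist_flip f g (x : 'I_n) :
  f x != g x -> dist f g = (dist (flip x f) g).+1.
Proof.
move=> fgx; rewrite /dist (cardsD1 x) inE fgx add1n; congr _.+1.
apply: eq_card => y; rewrite !inE ffunE val_eqE.
by case: eqP => [->|] /=; rewrite ?addbF //; case: (f x) (g x) fgx => [] [].
Qed.

(* A distance transform that treats one variable after the other: with
   W g = d + 1 on a set of assignments and 0 elsewhere, [relaxed W n f] is
   positive iff some g in the set is within distance d of f. *)
Fixpoint relaxed (W : assignment n -> nat) m f :=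
  if m is m'.+1 then maxn (relaxed W m' f) (relaxed W m' (flip m' f) - 1)
  else W f.

(** Strict lower bounds turn the maximum into a disjunction and the truncated subtraction into a
    shift, as v < a - 1 iff v + 1 < a. After [m] rounds only variables below [m] may have been
    flipped. *)
Lemma relaxed_ltP W m f v : m <= n ->
  v < relaxed W m f <->
  exists g, (forall x : 'I_n, m <= x -> g x = f x) /\ v + dist f g < W g.
Proof.
elim: m f v => [|m IH] f v le_m /=.
  split=> [lt_v|[g [fg]]]; first by exists f; rewrite distff addn0.
  have -> : g = f by apply/ffunP => x; apply: fg.
  by rewrite distff addn0.
pose x := Ordinal le_m.
have -> : (v < maxn (relaxed W m f) (relaxed W m (flip m f) - 1)) =
          (v < relaxed W m f) || (v.+1 < relaxed W m (flip m f)) by lia.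
split=> [/orP[]/IH|] => [/(_ (ltnW le_m))|/(_ (ltnW le_m))|].
- by case=> g [fg lt_v]; exists g; split=> // y /ltnW; apply: fg.
- case=> g [fg lt_v]; exists g; split=> [y lt_y|].
    by rewrite fg ?(ltnW lt_y) // ffunE gtn_eqF // addbF.
  rewrite (@dist_flip _ _ x) /= ?addnS //.
  by rewrite fg //= ffunE eqxx; case: (f x).
case=> g [fg lt_v]; have [fgx|fgx] := eqVneq (f x) (g x).
  apply/orP; left; apply/IH; first exact: ltnW.
  exists g; split=> // y; rewrite leq_eqVlt => /orP[/eqP e|]; last exact: fg.
  by rewrite (_ : y = x) //; apply: val_inj.
apply/orP; right; apply/IH; first exact: ltnW.
exists g; split; last by move: lt_v; rewrite (dist_flip fgx) /= addnS.
move=> y; rewrite ffunE leq_eqVlt => /orP[/eqP e|lt_y].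
  rewrite (_ : y = x); last exact: val_inj.
  by rewrite /= eqxx; case: (f x) (g x) fgx => [] [].
by rewrite fg // gtn_eqF // addbF.
Qed.

Definition filtered d (phi : cnf2 n) (W : assignment n -> nat) f :=
  if (0 < W f) && sat_cnf2 f phi then d.+1 else 0.

Lemma relaxed_filtered_gt0 d phi W f :
  0 < relaxed (filtered d phi W) n f <->
  exists g, [/\ 0 < W g, sat_cnf2 g phi & dist g f <= d].
Proof.
rewrite relaxed_ltP //; split=> [[g [_]]|[g [Wg sg fg]]].
  rewrite /filtered add0n distC; case: ifP => // /andP[Wg sg].
  by rewrite ltnS => fg; exists g.
exists g; split=> [x|]; first by rewrite leqNgt ltn_ord.
by rewrite /filtered Wg sg distC.
Qed.

(** Forward reachability: [A] describes the assignments available at the next stage. The final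
    witness lies one move beyond the last stage. *)
Fixpoint feasible d (A : assignment n -> Prop) (l : seq (cnf2 n)) : Prop :=
  if l is phi :: l' then
    feasible d (fun g => exists f, [/\ A f, sat_cnf2 f phi & dist f g <= d]) l'
  else exists f, A f.

Lemma feasibleP d A l :
  feasible d A l <->
  exists f : nat -> assignment n, A (f 0) /\ forall i, i < size l ->
    sat_cnf2 (f i) (nth [::] l i) /\ dist (f i) (f i.+1) <= d.
Proof.
elim: l A => [|phi l IH] A /=.
  by split=> [[f Af]|[f [Af _]]]; [exists (fun=> f) | exists (f 0)].
rewrite IH; split=> [[f [[f0 [Af sf near]] H]]|[f [Af H]]].
  by exists (fun i => if i is j.+1 then f j else f0); split=> // -[|i] // /H.
exists (f \o succn); split=> [|i]; last by apply: (H i.+1).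
by have [sf near] := H 0 isT; exists (f 0).
Qed.

Lemma feasible_multistage tau d (Phi : tau.-tuple (cnf2 n)) :
  feasible d (fun=> True) Phi <-> multistage_2sat d Phi.
Proof.
rewrite feasibleP size_tuple; split=> [[f [_ H]]|[f [sf near]]].
  exists (fun i => f i); split=> [i|i j ->].
    by rewrite (tnth_nth [::]); apply: (H i _).1.
  by have := (H i (ltn_ord i)).2.
case: tau Phi f sf near => [|tau] Phi f sf near.
  by exists (fun=> [ffun=> false]).
(* The last assignment is repeated, at distance 0, to supply the extra one after the last stage. *)
exists (fun i => f (inord (minn i tau))); split=> // i lt_i.
have -> : minn i tau = i by lia.
split; first by have := sf (inord i); rewrite (tnth_nth [::]) inordK.
have [lt|ge] := ltnP i tau; last by rewrite (_ : minn _ _ = i) ?distff //; lia.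
by rewrite (_ : minn _ _ = i.+1); [apply: near; rewrite !inordK | lia].
Qed.

Lemma eq_feasible d A A' l : (forall f, A f <-> A' f) ->
  feasible d A l <-> feasible d A' l.
Proof.
move=> eA; rewrite !feasibleP.
by split=> -[f [Af H]]; exists f; split=> //; apply/eA.
Qed.
End Assignments.

(** * Verification *)

Section Filter.
Variables (n : nat) (f : assignment n) (e : nat).

Definition row_bits (M : nat -> nat) (q : nat) :=
  forall x : 'I_n, M (q + x).+1 = f x.

Lemma runs_literals (c : seq (literal n)) u s :
  s.1 rone = 1 -> s.1 rlits = size c -> s.1 rtrue = 0 ->
  row_bits s.2 (s.1 rrow) ->
  segment s.2 (s.1 rscan) (flatten (map (@encode_literal n) c) ++ u) e ->
  runs (For rlits check_literal) s (size c * 15 + 1)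
    (fun s' => framed (For rlits check_literal) s s' /\
       ((0 < s'.1 rtrue) = has (sat_literal f) c /\
        segment s.2 (s'.1 rscan) u e)).
Proof.
case: s => R M /= s1 sl st rb hold; apply: runs_frame.
apply: (@runs_for_seq _ c (fun c' s' =>
  ((0 < s'.1 rtrue) || has (sat_literal f) c') = has (sat_literal f) c /\
  segment M (s'.1 rscan) (flatten (map (@encode_literal n) c') ++ u) e)
  12) => //.
- by rewrite /= st.
- move=> [x b] c' [R' M'] xc [/= <- [Mx [Mb hold']]] [frR /(_ isT)/= eM].
  unchanged frR rone as R1; unchanged frR rrow as Rq.
  apply: runs_ops; calc; rewrite eM R1 s1 addn1 Mx Mb !addn1 Rq.
  rewrite [x + _]addnC rb /sat_literal /=; split=> //.
  by case: (f x) b {xc Mb} => [] [] /=; lia.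
- by move=> s' []; rewrite /= orbF.
- by rewrite addn1.
Qed.

Lemma runs_clauses (phi : cnf2 n) u s :
  s.1 rone = 1 -> s.1 rclauses = size phi -> s.1 rok = 1 ->
  row_bits s.2 (s.1 rrow) ->
  segment s.2 (s.1 rscan) (flatten (map (@encode_clause n) phi) ++ u) e ->
  runs (For rclauses check_clause) s (size phi * 39 + 1)
    (fun s' => framed (For rclauses check_clause) s s' /\
       (s'.1 rok = sat_cnf2 f phi /\ segment s.2 (s'.1 rscan) u e)).
Proof.
case: s => R M /= s1 sl so rb hold; apply: runs_frame.
apply: (@runs_for_seq _ phi (fun phi' s' =>
  (s'.1 rok <= 1) /\
  ((0 < s'.1 rok) && sat_cnf2 f phi') = sat_cnf2 f phi /\
  segment M (s'.1 rscan) (flatten (map (@encode_clause n) phi') ++ u) e)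
  36) => //.
- by rewrite /= so.
- move=> c phi' [R' M'] _ [/= le1 [<-]].
  rewrite -catA => -[Mc hold'] [frR /(_ isT)/= eM].
  unchanged frR rone as R1; unchanged frR rrow as Rq.
  (* A clause has at most two literals, and 3 + 31 + 2 = 36. *)
  apply: (@runs_leq _ _ (3 + (size c * 15 + 1 + 2))).
    by have := size_bseq c; lia.
  apply: runs_seq; apply: runs_ops; apply: runs_seq.
  apply: (runs_imp _ (@runs_literals c
    (flatten (map (@encode_clause n) phi') ++ u) _ _ _ _ _ _));
    [|calc; rewrite ?eM ?R1 ?Rq ?s1 ?addn1 //..].
  move=> [R2 M2] [[frR2 _] []]; calc.
  unchanged frR2 rone as R21; unchanged frR2 rok as R2o.
  rewrite eM => htr hold2; apply: runs_ops; calc; rewrite R2o R21 R1 s1.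
  split; first by lia.
  split=> //.
  by rewrite /sat_cnf2 /= /sat_clause -htr andbA; congr (_ && _); lia.
- by move=> [R' M'] [/= le1 []] + hu _; rewrite andbT => <-; split=> //; lia.
- by rewrite addn1.
Qed.

Lemma runs_filter_row (phi : cnf2 n) u s :
  s.1 rone = 1 -> row_bits s.2 (s.1 rrow) ->
  segment s.2 (s.1 rinput) (encode_cnf2 phi ++ u) e ->
  runs filter_row s (size phi * 39 + 17)
    (fun s' => framed filter_row s s' /\
       let b := (0 < s.2 (s.1 rrow)) && sat_cnf2 f phi in
       [/\ s'.1 rrow = s.1 rrow + s.1 rwidth,
           s'.1 rans = (if b then 1 else s.1 rans),
           s'.2 = mset s.2 (s.1 rrow) (if b then s.1 rbudget else 0)
         & segment s.2 (s'.1 rscan) u e]).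
Proof.
case: s => R M /= s1 rb [Mi hold]; apply: runs_frame.
apply: (@runs_leq _ _ (4 + (size phi * 39 + 1 + (4 + (2 + 4 + 2))))).
  by lia.
apply: runs_seq; apply: runs_ops; apply: runs_seq.
apply: (runs_imp _ (@runs_clauses phi u _ _ _ _ _ _)); last first.
- by calc; rewrite s1 addn1.
- by [].
- by calc; rewrite s1.
- by calc; rewrite Mi.
- by calc; rewrite s1.
move=> [R1 M1] [[fr /(_ isT) + ] []]; calc => eM sat hold1.
unchanged fr rone as R11; unchanged fr rrow as R1q; unchanged fr rwidth as R1w.
unchanged fr rbudget as R1b; unchanged fr rans as R1a.
apply: runs_seq; apply: runs_ops; apply: runs_seq.
apply: (@runs_if ((0 < M (R rrow)) && sat_cnf2 f phi)) => //.
- by calc; rewrite R11.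
- calc; rewrite eM R1q R11 s1 sat; case: (sat_cnf2 _ _) (M _) => [] [] //=; lia.
- move=> b; apply: runs_ops; apply: runs_ops; calc.
  by rewrite b R11 R1q R1b R1w eM s1.
- move=> /negbTE b; apply: runs_ops; calc.
  by rewrite b R1q R1w R1a eM.
Qed.
End Filter.

(** * Filtering and relaxing the whole table *)

Section Table.
Variables (n B : nat) (M0 : nat -> nat).
Implicit Types (V : nat -> nat) (s : state).

Definition cell k := B + k * n.+1.

(** Rows are [n.+1] cells wide, so an offset inside a row reaches a value cell only if it is 0. *)
Lemma cell_inj j k x : x < n.+1 -> cell j + x = cell k -> x = 0 /\ j = k.
Proof.
rewrite /cell => lt_x e; have [lt|lt|eq_jk] := ltngtP j k; last by subst; lia.
- by have := leq_mul lt (leqnn n.+1); lia.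
- by have := leq_mul lt (leqnn n.+1); lia.
Qed.

(** Memory may differ from the reference [M0] at value cells only, so the input and the stored truth
    values survive every stage. *)
Definition with_values V (M : nat -> nat) :=
  (forall k, k < 2 ^ n -> M (cell k) = V k) /\
  (forall a, (forall k, k < 2 ^ n -> a <> cell k) -> M a = M0 a).

Lemma eq_with_values V V' M : (forall k, k < 2 ^ n -> V k = V' k) ->
  with_values V M -> with_values V' M.
Proof. by move=> eV [H H']; split=> // k lt_k; rewrite H // eV. Qed.

Lemma with_values_set V V' M k : k < 2 ^ n ->
  (forall j, j < 2 ^ n -> j != k -> V' j = V j) ->
  with_values V M -> with_values V' (mset M (cell k) (V' k)).
Proof.
move=> lt_k eV [H H']; split=> [j lt_j|a na]; rewrite msetE.
  case: eqP => [e|ne]; last by rewrite H // eV //; apply/eqP => e; rewrite e in ne.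
  by have [_ ->] := @cell_inj j k 0 isT ltac:(lia).
by case: eqP => [e|_]; [case: (na k) | apply: H'].
Qed.

Lemma with_values_input V M b : with_values V M -> b < B -> M b = M0 b.
Proof. by move=> [_ H] lt_b; apply: H => k _; rewrite /cell; lia. Qed.

Hypothesis bits : forall k, k < 2 ^ n -> row_bits (decode n k) M0 (cell k).

Lemma with_values_bits V M k : with_values V M -> k < 2 ^ n ->
  row_bits (decode n k) M (cell k).
Proof.
move=> [_ H] lt_k x; rewrite H ?bits // => j _ e.
by have [] := @cell_inj k j x.+1 ltac:(have := ltn_ord x; lia) ltac:(lia).
Qed.

Variable d : nat.

Definition env s :=
  [/\ s.1 rone = 1, s.1 rbase = B & s.1 rn = n] /\
  [/\ s.1 rbudget = d.+1, s.1 rwidth = n.+1 & s.1 rrows = 2 ^ n].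

Lemma env_frame c s s' :
  all (fun r => r \notin writes c) [:: rone; rbase; rn; rbudget; rwidth; rrows] ->
  framed c s s' -> env s -> env s'.
Proof.
case/and5P=> h1 h2 h3 h4 /and3P[h5 h6 _] [fr _] [[? ? ?] [? ? ?]].
by split; split; rewrite fr.
Qed.

Definition filter_values (phi : cnf2 n) V k :=
  if (0 < V k) && sat_cnf2 (decode n k) phi then d.+1 else 0.

Lemma runs_filter_rows (phi : cnf2 n) u V s :
  env s -> with_values V s.2 ->
  segment M0 (s.1 rinput) (encode_cnf2 phi ++ u) B ->
  runs filter_rows s (2 ^ n * (size phi * 39 + 20) + 5)
    (fun s' => framed filter_rows s s' /\
      [/\ with_values (filter_values phi V) s'.2,
          segment M0 (s'.1 rinput) u B
        & s'.1 rans = has (fun k => 0 < filter_values phi V k) (iota 0 (2 ^ n))]).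
Proof.
case: s => R M es wv seg; have [[/= s1 sB sn] [sd sw sp]] := es.
apply: runs_frame.
apply: (@runs_leq _ _ (3 + (2 ^ n * (size phi * 39 + 20) + 1 + 1))).
  by lia.
apply: runs_seq; apply: runs_ops; apply: runs_seq.
(* The intermediate table in which the rows below [j] have been processed. *)
pose W j k := if k < j then filter_values phi V k else V k.
apply: (@runs_for_nat (2 ^ n) (fun j s' =>
  [/\ s'.1 rrow = cell j, with_values (W j) s'.2,
      s'.1 rans = has (fun k => 0 < filter_values phi V k) (iota 0 j)
    & 0 < j -> segment M0 (s'.1 rscan) u B])
  (fun j => j * (size phi * 39 + 20)) (fun=> size phi * 39 + 17)) => //.
- by calc; split=> //; rewrite sB /cell; lia.
- move=> j [R' M'] lt_j [/= Rq wv' Ra _] [fr _].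
  unchanged fr rone as R1; unchanged fr rinput as Ri; unchanged fr rwidth as Rw.
  unchanged fr rbudget as Rb.
  have rb := with_values_bits wv' lt_j.
  apply: (runs_imp _ (@runs_filter_row n (decode n j) B phi u _ _ _ _)).
  + move=> [R2 M2] [_ []]; calc; rewrite Rq Rw Ra Rb sd sw.
    rewrite (wv'.1 _ lt_j) {1 2}/W ltnn => -> -> -> seg2; split=> //.
    * by rewrite /cell; lia.
    * rewrite -[X in mset _ _ X]/(filter_values phi V j).
      rewrite (_ : filter_values phi V j = W j.+1 j); last by rewrite /W ltnSn.
      apply: with_values_set wv' => // k _ ne; rewrite /W; congr (if _ then _ else _).
      by rewrite ltnS leq_eqVlt (negbTE ne).
    * rewrite -[_ || _]/(has _ (iota 0 j.+1)) -[j.+1]addn1 iotaD has_cat orbC.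
      by rewrite /= add0n orbF /filter_values; case: ifP.
    * move=> _; apply: (eq_segment _ seg2) => b lt_b.
      by rewrite (with_values_input wv' lt_b).
  + by calc; rewrite R1.
  + by calc; rewrite Rq.
  + calc; rewrite Ri; apply: (eq_segment _ seg) => b.
    exact: with_values_input wv'.
- move=> [R' M'] [/= Rq wv' Ra seg'] _; apply: runs_ops; calc; split=> //.
    by apply: eq_with_values wv' => k lt_k; rewrite /W lt_k.
  (* There is at least one row, so [rscan] has moved past the formula to the next stage. *)
  by apply: seg'; rewrite expn_gt0.
- by move=> j _; rewrite mulSn; lia.
- by rewrite addn1.
Qed.

Lemma runs_relax_row b s :
  s.1 rone = 1 -> s.2 (s.1 rrow + s.1 rcol) = nat_of_bool b ->
  runs relax_row s 15
    (fun s' => framed relax_row s s' /\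
      let q := s.1 rrow in
      let a := if b then q - s.1 rstride else q + s.1 rstride in
      s'.1 rrow = q + s.1 rwidth /\
      s'.2 = mset s.2 q (maxn (s.2 q) (s.2 a - 1))).
Proof.
case: s => R M /= s1 Mb; apply: runs_frame.
apply: (@runs_leq _ _ (3 + (1 + 4 + 7))) => //.
apply: runs_seq; apply: runs_ops; apply: runs_seq.
apply: (@runs_if b) => //.
- move=> tb; apply: runs_ops; apply: runs_ops; calc; rewrite tb s1; split=> //.
  (* With truncated subtraction, u + ((v - 1) - u) is the maximum of u and v - 1. *)
  by congr mset; lia.
- move=> /negbTE tb; apply: runs_ops; calc; rewrite tb s1; split=> //.
  by congr mset; lia.
Qed.

Definition relax_values m V k := maxn (V k) (V (partner k m) - 1).

Lemma runs_relax_dim m V s : m < n ->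
  env s -> with_values V s.2 ->
  s.1 rcol = m.+1 -> s.1 rstride = 2 ^ m * n.+1 ->
  runs relax_dim s (2 ^ n * 18 + 5)
    (fun s' => framed relax_dim s s' /\
      [/\ with_values (relax_values m V) s'.2,
          s'.1 rcol = m.+2 & s'.1 rstride = 2 ^ m.+1 * n.+1]).
Proof.
case: s => R M lt_m es; have [[/= s1 sB sn] [sd sw sp]] := es.
move=> wv sc ss; apply: runs_frame.
apply: (@runs_leq _ _ (2 + (2 ^ n * 18 + 1 + 2))).
  by lia.
apply: runs_seq; apply: runs_ops; apply: runs_seq.
(* Updating in place is harmless: if the partner p of j has been updated already,
   its value is max (V p) (V j - 1), and the second term has no influence. *)
pose W j k := if k < j then relax_values m V k else V k.
apply: (@runs_for_nat (2 ^ n) (fun j s' =>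
  s'.1 rrow = cell j /\ with_values (W j) s'.2)
  (fun j => j * 18) (fun=> 15)) => //.
- by calc; split=> //; rewrite sB /cell; lia.
- move=> j [R' M'] lt_j [/= Rq wv'] [fr _].
  unchanged fr rone as R1; unchanged fr rcol as Rc; unchanged fr rwidth as Rw.
  unchanged fr rstride as Rs.
  have lt_p := partner_lt lt_m lt_j.
  apply: (runs_imp _ (@runs_relax_row (bit j m) _ _ _)).
  + move=> [R2 M2] [_ []]; calc; rewrite Rq Rw Rs ss sw (wv'.1 _ lt_j).
    rewrite (_ : (if bit j m then _ else _) = cell (partner j m)); last first.
      rewrite /partner /cell; case: ifP => b; last by rewrite mulnDl addnA.
      by rewrite mulnBl addnBA // leq_mul2r bit_leq ?orbT.
    rewrite wv'.1 // => -> ->; split; first by rewrite /cell; lia.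
    rewrite (_ : maxn _ _ = W j.+1 j).
      apply: with_values_set wv' => // k _ ne; rewrite /W; congr (if _ then _ else _).
      by rewrite ltnS leq_eqVlt (negbTE ne).
    rewrite /W ltnn ltnSn /relax_values; case: ifP => // _.
    by rewrite partnerK; lia.
  + by calc; rewrite R1.
  + calc; rewrite Rq Rc sc addnS.
    by have := with_values_bits wv' lt_j (Ordinal lt_m); rewrite ffunE.
- move=> [R' M'] [/= Rq wv'] [fr _].
  unchanged fr rone as R1; unchanged fr rcol as Rc; unchanged fr rstride as Rs.
  apply: runs_ops; calc; split.
  + by apply: eq_with_values wv' => k lt_k; rewrite /W lt_k.
  + by rewrite Rc R1 sc s1 addn1.
  + by rewrite Rs ss expnS; lia.
- by move=> j _; rewrite mulSn; lia.
- by rewrite addn1.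
Qed.

Fixpoint relaxed_values m V :=
  if m is m'.+1 then relax_values m' (relaxed_values m' V) else V.

Lemma runs_relax_rows V s :
  env s -> with_values V s.2 ->
  runs relax_rows s (n * (2 ^ n * 18 + 8) + 4)
    (fun s' => framed relax_rows s s' /\ with_values (relaxed_values n V) s'.2).
Proof.
case: s => R M es; have [[/= s1 sB sn] [sd sw sp]] := es.
move=> wv; apply: runs_frame.
apply: (@runs_leq _ _ (3 + (n * (2 ^ n * 18 + 8) + 1))).
  by lia.
apply: runs_seq; apply: runs_ops.
apply: (@runs_for_nat n (fun m s' =>
  [/\ with_values (relaxed_values m V) s'.2,
          s'.1 rcol = m.+1 & s'.1 rstride = 2 ^ m * n.+1])
  (fun m => m * (2 ^ n * 18 + 8)) (fun=> 2 ^ n * 18 + 5)) => //.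
- by calc; rewrite mul1n.
- move=> m s' lt_m [wv' rc rs] fr.
  apply: (runs_imp _ (@runs_relax_dim m _ _ lt_m _ wv' rc rs)).
    by move=> [R2 M2] [_ [wv2 rc2 rs2]]; calc.
  by apply: env_frame fr es.
- by move=> s' [].
- by move=> j _; rewrite mulSn; lia.
- by rewrite addn1.
Qed.
End Table.

(** * Building the table of all assignments *)

Lemma runs_copy_cells w s :
  s.1 rone = 1 -> s.1 rcells = w -> s.1 rsrc + w <= s.1 rdst ->
  runs (For rcells copy_cell) s (w * 7 + 1)
    (fun s' => framed (For rcells copy_cell) s s' /\
      [/\ s'.1 rsrc = s.1 rsrc + w, s'.1 rdst = s.1 rdst + w,
          forall x, x < w -> s'.2 (s.1 rdst + x) = s.2 (s.1 rsrc + x)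
        & forall a, a < s.1 rdst -> s'.2 a = s.2 a]).
Proof.
case: s => R M /= s1 sw le; apply: runs_frame.
apply: (@runs_for_nat w (fun j s' =>
  [/\ s'.1 rsrc = R rsrc + j, s'.1 rdst = R rdst + j,
      forall x, x < j -> s'.2 (R rdst + x) = M (R rsrc + x)
    & forall a, a < R rdst -> s'.2 a = M a])
  (fun j => j * 7) (fun=> 4)) => //.
- by calc; rewrite !addn0.
- move=> j [R' M'] lt_j [/= Rs Rd copied old] [fr _].
  unchanged fr rone as R1.
  (* The source ends before the destination begins, so the cell read still has its original
     content. *)
  apply: runs_ops; calc; rewrite R1 s1 Rs Rd old; last by lia.
  split; rewrite ?addn1 ?addnS //.
  + move=> x; rewrite ltnS leq_eqVlt msetE eqn_add2l => /orP[/eqP ->|lt_x].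
      by rewrite eqxx.
    by rewrite ltn_eqF // copied.
  + by move=> a lt_a; rewrite msetE ltn_eqF ?old //; lia.
- by move=> j _; rewrite mulSn; lia.
- by rewrite addn1.
Qed.

Lemma runs_add_row w s :
  s.1 rone = 1 -> s.1 rwidth = w -> s.1 rcol < w ->
  s.1 rsrc + w <= s.1 rdst ->
  runs add_row s (w * 7 + 4)
    (fun s' => framed add_row s s' /\
      [/\ s'.1 rsrc = s.1 rsrc + w, s'.1 rdst = s.1 rdst + w,
          forall x, x < w -> s'.2 (s.1 rdst + x) =
            if x == s.1 rcol then 1 else s.2 (s.1 rsrc + x)
        & forall a, a < s.1 rdst -> s'.2 a = s.2 a]).
Proof.
case: s => R M /= s1 sw lt_c le; apply: runs_frame.
apply: (@runs_leq _ _ (2 + (w * 7 + 1 + 1))); first by lia.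
apply: runs_seq; apply: runs_ops; apply: runs_seq.
apply: (runs_imp _ (@runs_copy_cells w _ _ _ _)) => //.
move=> [R' M'] [[fr _] []]; calc => Rs Rd copied old.
unchanged fr rone as R1; unchanged fr raddr as Ra.
apply: runs_ops; calc; rewrite Ra R1 s1; split=> // [x lt_x|a lt_a].
  by rewrite msetE eqn_add2l; case: eqP => // _; apply: copied.
by rewrite msetE ltn_eqF ?old //; lia.
Qed.

(* Initially every assignment has a positive value, that is, may be chosen. *)
Definition row_value k x : nat := if x is y.+1 then bit k y else 1.

Definition table n B N (M : nat -> nat) :=
  forall k x, k < N -> x < n.+1 -> M (cell n B k + x) = row_value k x.

Lemma runs_add_bit n B m s : m < n ->
  s.1 rone = 1 -> s.1 rbase = B -> s.1 rwidth = n.+1 ->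
  s.1 rrows = 2 ^ m -> s.1 rcol = m.+1 -> s.1 rdst = cell n B (2 ^ m) ->
  table n B (2 ^ m) s.2 ->
  runs add_bit s (2 ^ m * (n.+1 * 7 + 7) + 5)
    (fun s' => framed add_bit s s' /\
      [/\ s'.1 rrows = 2 ^ m.+1, s'.1 rcol = m.+2,
          s'.1 rdst = cell n B (2 ^ m.+1), table n B (2 ^ m.+1) s'.2
        & forall a, a < B -> s'.2 a = s.2 a]).
Proof.
case: s => R M lt_m /= s1 sB sw sr sc sd tab; apply: runs_frame.
apply: (@runs_leq _ _ (2 + (2 ^ m * (n.+1 * 7 + 7) + 1 + 2))); first by lia.
apply: runs_seq; apply: runs_ops; apply: runs_seq.
apply: (@runs_for_nat (2 ^ m) (fun j s' =>
  [/\ s'.1 rsrc = cell n B j, s'.1 rdst = cell n B (2 ^ m + j),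
      table n B (2 ^ m + j) s'.2 & forall a, a < B -> s'.2 a = M a])
  (fun j => j * (n.+1 * 7 + 7)) (fun=> n.+1 * 7 + 4)) => //.
- by calc; rewrite sB sd addn0 /cell mul0n addn0.
- move=> j [R' M'] lt_j [/= Rs Rd tab' old] [fr _].
  unchanged fr rone as R1; unchanged fr rwidth as Rw; unchanged fr rcol as Rc.
  apply: (runs_imp _ (@runs_add_row n.+1 _ _ _ _ _)).
  + move=> [R2 M2] [_ []]; calc; rewrite Rs Rd Rc sc => R2s R2d new old2.
    split.
    * by rewrite R2s /cell; lia.
    * by rewrite R2d /cell; lia.
    * move=> k x lt_k lt_x; have [lt|ge] := ltnP k (2 ^ m + j).
        rewrite old2 ?tab' // /cell.
        by have := leq_mul lt (leqnn n.+1); lia.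
      have -> : k = 2 ^ m + j by lia.
      rewrite new // tab' //; last by lia.
      case: x lt_x => [|x] //= lt_x; rewrite eqSS addnC.
      (* Row 2^m + j is row j with bit m set, since j < 2^m has bit m clear. *)
      rewrite (bit_add _ (bit_small lt_j)).
      by case: eqP => [->|_]; rewrite ?(bit_small lt_j) ?addbF.
    * by move=> a lt_a; rewrite old2 ?old //; rewrite /cell; lia.
  + by calc; rewrite R1.
  + by calc; rewrite Rw.
  + by calc; rewrite Rc sc.
  + calc; rewrite Rs Rd /cell.
    by have := leq_mul lt_j (leqnn n.+1); rewrite mulnDl; lia.
- move=> [R' M'] [/= Rs Rd tab' old] [fr _].
  unchanged fr rone as R1; unchanged fr rrows as Rr; unchanged fr rcol as Rc.
  have e : 2 ^ m + 2 ^ m = 2 ^ m.+1 by rewrite expnS mul2n addnn.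
  rewrite e in Rd tab'.
  by apply: runs_ops; calc; rewrite Rr Rc R1 s1 sr sc e addn1.
- by move=> j _; rewrite mulSn; lia.
- by rewrite addn1.
Qed.

Lemma runs_add_bits n B s :
  s.1 rone = 1 -> s.1 rbase = B -> s.1 rwidth = n.+1 -> s.1 rdim = n ->
  s.1 rrows = 1 -> s.1 rcol = 1 -> s.1 rdst = cell n B 1 ->
  table n B 1 s.2 ->
  runs (For rdim add_bit) s (2 ^ n * (n.+1 * 7 + 7) + n * 8 + 1)
    (fun s' => framed (For rdim add_bit) s s' /\
      [/\ s'.1 rrows = 2 ^ n, table n B (2 ^ n) s'.2
        & forall a, a < B -> s'.2 a = s.2 a]).
Proof.
case: s => R M /= s1 sB sw si sr sc sd tab; apply: runs_frame.
apply: (@runs_for_nat n (fun m s' =>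
  [/\ s'.1 rrows = 2 ^ m, s'.1 rcol = m.+1,
      s'.1 rdst = cell n B (2 ^ m), table n B (2 ^ m) s'.2
        & forall a, a < B -> s'.2 a = M a])
  (* A geometric sum: round [m] costs about as much as the potential [2 ^ m * (n.+1 * 7 + 7)], which
     it doubles. *)
  (fun m => 2 ^ m * (n.+1 * 7 + 7) + m * 8)
  (fun m => 2 ^ m * (n.+1 * 7 + 7) + 5)) => //.
- move=> m [R' M'] lt_m [/= Rr Rc Rd tab' old] [fr _].
  unchanged fr rone as R1; unchanged fr rwidth as Rw; unchanged fr rbase as RB.
  apply: (runs_imp _ (@runs_add_bit n B m (R', M') lt_m _ _ _ Rr Rc Rd tab')).
  + move=> [R2 M2] [_ []]; calc=> ? ? ? ? old2; split=> // a lt_a.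
    by rewrite old2 ?old.
  + by calc; rewrite R1.
  + by calc; rewrite RB.
  + by calc; rewrite Rw.
- by move=> s' [].
- by move=> m _; rewrite expnS; lia.
- by rewrite addn1.
Qed.

(** * The loop over the stages *)

Section Stages.
Variables (n d : nat).
Implicit Types (V : nat -> nat) (W : assignment n -> nat).

Definition codes V W := forall k, k < 2 ^ n -> V k = W (decode n k).

Lemma codes_filter phi V W :
  codes V W -> codes (filter_values d phi V) (filtered d phi W).
Proof. by move=> VW k lt_k; rewrite /filter_values /filtered VW. Qed.

Lemma codes_relaxed m V W : m <= n ->
  codes V W -> codes (relaxed_values m V) (relaxed W m).
Proof.
elim: m => [|m IH] // lt_m VW k lt_k /=; rewrite /relax_values.
by rewrite !(IH (ltnW lt_m) VW) ?decode_partner // partner_lt.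
Qed.

Lemma codes_gt0 V W : codes V W ->
  has (fun k => 0 < V k) (iota 0 (2 ^ n)) <-> exists f, 0 < W f.
Proof.
move=> VW; split=> [/hasP[k]|[f Wf]].
  by rewrite mem_iota => /andP[_ lt_k]; rewrite VW // => Wk; exists (decode n k).
have [k lt_k e] := decode_onto f; apply/hasP; exists k; rewrite ?mem_iota //.
by rewrite VW // e.
Qed.

Variables (B : nat) (M0 : nat -> nat) (mx : nat).
Hypothesis bits : forall k, k < 2 ^ n -> row_bits (decode n k) M0 (cell n B k).

(** Filtering and relaxing cost 2^n (39 mx + 18 n + 20) + 8 n + 9; the summand 8 n + 9 is absorbed
    into the factor of 2^n. *)
Definition stage_time := 2 ^ n * (mx * 39 + n * 26 + 29).

Lemma runs_stages (l : seq (cnf2 n)) s :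
  (forall phi, phi \in l -> size phi <= mx) ->
  env n B d s -> with_values n B M0 (fun=> 1) s.2 ->
  segment M0 (s.1 rinput) (flatten (map (@encode_cnf2 n) l)) B ->
  s.1 rstages = size l -> s.1 rans = 1 ->
  runs (For rstages (filter_rows;; relax_rows)) s
    (size l * (stage_time + 3) + 1)
    (fun s' => exists b : bool, s'.1 rans = b /\
       (b <-> feasible d (fun _ : assignment n => True) l)).
Proof.
move=> le_mx es wv seg sl sa.
apply: (@runs_for_seq _ l (fun l' s' => exists V W (b : bool),
  [/\ with_values n B M0 V s'.2, codes V W,
      segment M0 (s'.1 rinput) (flatten (map (@encode_cnf2 n) l')) B,
      feasible d (fun f => 0 < W f) l' <-> feasible d (fun=> True) l
    & s'.1 rans = b /\ (b <-> exists f, 0 < W f)]) stage_time) => //.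
- by case: es => -[].
- exists (fun=> 1), (fun=> 1), true; split=> //.
    by apply: eq_feasible.
  by split=> //; split=> // _; exists [ffun=> false].
- move=> phi l' s' phil [V [W [b [wv' VW seg' feas _]]]] fr.
  have es' : env n B d s' by apply: env_frame fr es.
  apply: (@runs_leq _ _
    (2 ^ n * (size phi * 39 + 20) + 5 + (n * (2 ^ n * 18 + 8) + 4))).
    rewrite /stage_time; have := le_mx _ phil; have : 0 < 2 ^ n by rewrite expn_gt0.
    nia.
  apply: runs_seq.
  apply: (runs_imp _ (@runs_filter_rows n B M0 bits d phi _ V _ es' wv' seg')).
  move=> [R1 M1] [fr1 [wv1 seg1 /= ans1]].
  have es1 : env n B d (R1, M1) by apply: env_frame fr1 es'.
  apply: (runs_imp _ (@runs_relax_rows n B M0 bits d _ _ es1 wv1)).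
  move=> [R2 M2] [[fr2 _] wv2].
  unchanged fr2 rinput as R2i; unchanged fr2 rans as R2a.
  exists (relaxed_values n (filter_values d phi V)), (relaxed (filtered d phi W) n).
  exists (has (fun k => 0 < filter_values d phi V k) (iota 0 (2 ^ n))).
  split=> //.
  + exact/codes_relaxed/codes_filter.
  + by calc; rewrite R2i.
  + rewrite -feas /=; apply: eq_feasible => f; exact: relaxed_filtered_gt0.
  + split; first by calc; rewrite R2a.
    (* The answer is recorded before relaxation, which does not affect whether some value is
       positive: every surviving assignment is at distance 0 from itself. *)
    rewrite (codes_gt0 (codes_filter phi VW)); split=> [[f]|[f]].
      rewrite /filtered; case: ifP => // /andP[Wf sf] _.
      by exists f; apply/relaxed_filtered_gt0; exists f; rewrite distff.
    case/relaxed_filtered_gt0 => g [Wg sg _].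
    by exists g; rewrite /filtered Wg sg.
- by move=> s' [V [W [b [_ _ _ /= feas [sb bP]]]]] _; exists b; rewrite -feas.
- by rewrite addn1.
Qed.
End Stages.

(** * The complete machine and its running time *)

Definition machine : program := Const rone 1 :: compile 1 main.

Lemma runs_main n tau d (Phi : tau.-tuple (cnf2 n)) (R : nat -> nat) :
  let w := encode d Phi in
  R rone = 1 -> R rbase = size w ->
  runs main (R, nth 0 w)
    (2 ^ n * (n.+1 * 7 + 7) + n * 8 + tau * (stage_time n (max_clauses Phi) + 3) + 17)
    (fun s' => exists b : bool, s'.1 0 = b /\ (b <-> multistage_2sat d Phi)).
Proof.
move=> w R1 RB; have [M0n [Md [Mt seg]]] := segment_nth 0 w.
set B := size w in RB seg.
apply: (@runs_leq _ _ (14 + (2 ^ n * (n.+1 * 7 + 7) + n * 8 + 1 +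
  (size Phi * (stage_time n (max_clauses Phi) + 3) + 1 + 1)))).
  rewrite size_tuple; move: (2 ^ n * _) (tau * _) => x y; clear; lia.
apply: runs_seq; apply: runs_ops; apply: runs_seq.
apply: (runs_imp _ (@runs_add_bits n B _ _ _ _ _ _ _ _ _)) => //; last first.
- move=> [|k] x // _ lt_x; calc; rewrite RB /cell mul0n addn0 msetE.
  case: x lt_x => [|x] lt_x; first by rewrite addn0 eqxx.
  rewrite gtn_eqF; last by rewrite addnS ltnS leq_addr.
  (* Cells behind the input read as 0, the bits of row 0. *)
  by rewrite nth_default ?leq_addr //= bit_small ?expn_gt0.
- by calc; rewrite RB M0n R1 /cell mul1n addn1.
- by calc; rewrite M0n R1 addn1.
move=> [R1' M1] [[fr1 _] []]; calc => rows tab old.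
unchanged fr1 rone as R11; unchanged fr1 rbase as R1B; unchanged fr1 rn as R1n.
unchanged fr1 rbudget as R1d; unchanged fr1 rwidth as R1w.
unchanged fr1 rinput as R1i; unchanged fr1 rstages as R1t.
unchanged fr1 rans as R1a.
have {}old a : a < B -> M1 a = nth 0 w a.
  by move=> lt_a; rewrite old // msetE RB ltn_eqF.
apply: runs_seq.
apply: (runs_imp _ (@runs_stages n d B M1 (max_clauses Phi) _ Phi _ _ _ _ _ _ _)).
- move=> [R2 M2] [b [Rb bP]]; apply: runs_ops; exists b; split=> //.
  by rewrite -feasible_multistage.
- by move=> k lt_k x; rewrite -addnS tab ?ffunE // ltnS ltn_ord.
- move=> phi /tnthP[i ->]; by rewrite /max_clauses (bigD1 i) //= leq_maxl.
- split; split; calc; rewrite ?R11 ?R1B ?R1n ?R1d ?R1w ?M0n ?Md ?R1 ?addn1 //.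
- split=> // k lt_k; calc; rewrite -[cell _ _ _]addn0 tab //.
- calc; rewrite R1i R1; apply: (eq_segment _ seg) => a lt_a; exact: old.
- by calc; rewrite R1t R1 Mt size_tuple.
- by calc; rewrite R1a R1.
Qed.

(* For n = 0 and d > 0 the bound is 0, which no algorithm meets; the time bound
   is claimed for nonempty variable sets, correctness for all instances. *)
Theorem theorem4p1 :
  exists (P : program) (C : nat),
    forall (n tau d : nat) (Phi : tau.-tuple (cnf2 n)),
      0 < tau ->
      exists (t : nat) (b : bool),
        [/\ answers_within P (encode d Phi) t b,
            b <-> multistage_2sat d Phi
          & 0 < n ->
            t <= C * (minn (2 ^ n * n ^ d) (4 ^ n) * tau * (n + max_clauses Phi))].
Proof.
exists machine, 200 => n tau d Phi tau_gt0.
set w := encode d Phi; pose R := rset (reg (init w)) rone 1.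
have [le_t [b [sb bP]]] := @runs_main n tau d Phi R erefl erefl.
(* The additional step is the initial [Const]; afterwards the machine halts by running off the end
   of the code. *)
exists (time main (R, nth 0 w)).+1, b; split=> //.
  rewrite /answers_within iterSr.
  have -> : step machine (init w) = Config 1 (R, nth 0 w).1 (R, nth 0 w).2 by [].
  have [_ seg] := segment_nth Halt machine.
  rewrite (compile_ok wf_main _ seg) //.
move=> n_gt0; move: (max_clauses Phi) le_t => m le_t.
have le_min : 2 ^ n <= minn (2 ^ n * n ^ d) (4 ^ n).
  by rewrite leq_min leq_pmulr ?expn_gt0 ?n_gt0 // leq_exp2r.
apply: leq_trans (_ : 200 * (2 ^ n * tau * (n + m)) <= _); last first.
  by rewrite leq_mul2l !leq_mul.
apply: (leq_ltn_trans le_t); rewrite /stage_time.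
have : 0 < 2 ^ n by rewrite expn_gt0.
move: (2 ^ n) => N N_gt0.
have leN : N <= N * tau by rewrite leq_pmulr.
have le_tau : tau <= N * tau by rewrite leq_pmull.
(* The costs outside the stages stay below 50 n and those of the stages below 60 n + 40 m, each
   times 2^n tau; 200 (n + m) exceeds the sum. *)
have le_s : N * (n.+1 * 7 + 7) + n * 8 + 17 < N * tau * (n * 50).
  have : N * (n.+1 * 7 + 7) + n * 8 + 17 < N * (n * 50) by nia.
  by move/leq_trans; apply; apply: leq_mul.
have : tau * (N * (m * 39 + n * 26 + 29) + 3) <= N * tau * (n * 60 + m * 40).
  rewrite [N * tau]mulnC -mulnA leq_mul2l; apply/orP; right; nia.
move: (N * tau) le_s => q; lia.
Qed.
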